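(* Let $\mathbb{H}$ be the group of Hamiltonian quaternions (the quaternion group of order $8$). Neither the group ring $\mathbb{Z}_2[\mathbb{H}]$ nor the group ring $\mathbb{Z}_3[\mathbb{H}]$ is a field.
   Context: $\mathbb{H}=\{e,-e,i,-i,j,-j,k,-k\}$ with identity $e$, $i^2=j^2=k^2=-e$, $ij=-ji=k$, $jk=-kj=i$, $ki=-ik=j$. $\mathbb{Z}_p$ denotes the field with $p$ elements, and $K[G]$ denotes the group ring of the group $G$ over the ring $K$. *)

(* Defs.v *)
From HB Require Import structures.
From mathcomp Require Import all_boot all_order all_fingroup all_algebra.
From mathcomp Require Import all_solvable.

Set Implicit Arguments.
Unset Strict Implicit.
Unset Printing Implicit Defensive.

Import GroupScope GRing.Theory.

(* The group ring K[gT] of a finite group: a formal sum \sum_g a_g g is the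
   function g |-> a_g.  An alias, because {ffun gT -> K} already carries the
   pointwise product. *)
Definition groupRing (K : nzRingType) (gT : finGroupType) := {ffun gT -> K}.
Arguments groupRing K%_type gT%_type.

Section GroupRing.

Local Open Scope ring_scope.

Variables (K : nzRingType) (gT : finGroupType).
Local Notation KG := (groupRing K gT).
Implicit Types (a b c : KG) (g h : gT).

HB.instance Definition _ := GRing.Zmodule.copy KG {ffun gT -> K}.

(* The coefficient at g of (\sum_h a_h h) (\sum_k b_k k), where h k = g. *)
Definition groupRing_mul a b : KG :=
  [ffun g => \sum_(h : gT) a h * b (h^-1 * g)%g].

Definition groupRing_of g : KG := [ffun h => (h == g)%:R].

Fact groupRing_mulA : associative groupRing_mul.
Proof.
move=> a b c; apply/ffunP=> g; rewrite !ffunE.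
under eq_bigr => h _.
  rewrite ffunE mulr_sumr (reindex_inj (mulgI h^-1%g)) /=.
  under eq_bigr => k _ do rewrite invMg invgK -mulgA mulKVg mulrA.
  over.
rewrite exchange_big /=; apply: eq_bigr => k _.
by rewrite ffunE mulr_suml.
Qed.

Fact groupRing_mul1 : left_id (groupRing_of 1%g) groupRing_mul.
Proof.
move=> a; apply/ffunP=> g; rewrite ffunE (bigD1 1%g) //= ffunE eqxx mul1r.
rewrite invg1 mul1g big1 ?addr0 // => h /negPf h1.
by rewrite ffunE h1 mul0r.
Qed.

Fact groupRing_mulr1 : right_id (groupRing_of 1%g) groupRing_mul.
Proof.
move=> a; apply/ffunP=> g; rewrite ffunE (bigD1 g) //= ffunE mulVg eqxx mulr1.
rewrite big1 ?addr0 // => h hg.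
by rewrite ffunE -eq_mulVg1 (negPf hg) mulr0.
Qed.

Fact groupRing_mulDl : left_distributive groupRing_mul +%R.
Proof.
move=> a b c; apply/ffunP=> g; rewrite !ffunE -big_split /=.
by apply: eq_bigr => h _; rewrite ffunE mulrDl.
Qed.

Fact groupRing_mulDr : right_distributive groupRing_mul +%R.
Proof.
move=> a b c; apply/ffunP=> g; rewrite !ffunE -big_split /=.
by apply: eq_bigr => h _; rewrite ffunE mulrDr.
Qed.

Fact groupRing_1neq0 : groupRing_of 1%g != 0.
Proof.
by apply/eqP=> /ffunP/(_ 1%g)/eqP; rewrite !ffunE eqxx oner_eq0.
Qed.

HB.instance Definition _ := GRing.Zmodule_isNzRing.Build KG
  groupRing_mulA groupRing_mul1 groupRing_mulr1
  groupRing_mulDl groupRing_mulDr groupRing_1neq0.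

Lemma groupRing_ofM g h :
  groupRing_of (g * h)%g = groupRing_of g * groupRing_of h :> KG.
Proof.
apply/ffunP=> k; rewrite !ffunE (bigD1 g) //= !ffunE eqxx mul1r.
rewrite big1 ?addr0 => [|l /negPf lg]; last by rewrite ffunE lg mul0r.
by rewrite (can2_eq (mulKVg g) (mulKg g)).
Qed.

End GroupRing.

Definition is_field (R : pzRingType) : Prop :=
  [/\ commutative ( *%R : R -> R -> R),
      (1 : R) != 0
    & forall x : R, x != 0 -> exists y : R, x * y = 1]%R.

(* The quaternion group of the library is defined by a presentation; it has the
   multiplication table of {e, -e, i, -i, j, -j, k, -k}, with m for -e. *)
Lemma quaternion8_table : exists i j k m : 'Q_8%type,
  [/\ [/\ m != 1, m ^+ 2 = 1 & forall x : 'Q_8%type, m * x = x * m],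
      [/\ i ^+ 2 = m, j ^+ 2 = m & k ^+ 2 = m],
      [/\ i * j = k, j * k = i & k * i = j],
      [/\ j * i = m * k, k * j = m * i & i * k = m * j]
    & perm_eq (enum 'Q_8) [:: 1; m; i; m * i; j; m * j; k; m * k]].
Proof.
have [[x y]] := @generators_quaternion _ [set: 'Q_8%type]%G 3 isT (isog_refl _).
case=> oG _ ox; rewrite inE => /andP[nXy _] [_ y2 xy].
have {}oG : #|[set: 'Q_8%type]| = 8 := oG.
rewrite [(2 ^ _)%N]/= in ox; rewrite [(2 ^ _)%N]/= in y2; rewrite /= in nXy xy.
set m := (x ^+ 2) in y2 *.
have m2 : (m * m = 1) by rewrite -expgD -[RHS](expg_order x) ox.
have mx : (m * x = x * m) by rewrite -expgSr -expgS.
have my : (m * y = y * m) by rewrite -y2 -expgSr -expgS.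
have yx : (y * x = m * (x * y)).
  have E : (x * y = y * x^-1) by rewrite -xy conjgE mulgA mulgV mul1g.
  have xV : (x^-1 = m * x) by apply/eqP; rewrite eq_invg_mul mulgA -mx -mulgA
    -[(x * x)]/m m2.
  by rewrite E mulgA my -mulgA xV (mulgA m m) m2 mul1g.
have Xg a b : (x ^+ a == x ^+ b) = (a == b %[mod 4]).
  by rewrite eq_expg_mod_order ox.
have XY a b : (x ^+ a == x ^+ b * y) = false.
  apply: contraNF nXy => /eqP E.
  by rewrite -(groupMl y (mem_cycle x b)) -E mem_cycle.
have YX a b : (x ^+ b * y == x ^+ a) = false by rewrite eq_sym XY.
have e8 : [:: 1; m; x; m * x; y; m * y; x * y; m * (x * y)] =
    [seq x ^+ a | a <- [:: 0; 2; 1; 3]%N]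
      ++ [seq x ^+ a * y | a <- [:: 0; 2; 1; 3]%N].
  by rewrite /= expg0 expg1 mul1g mulgA -expgSr.
have u8 : uniq [:: 1; m; x; m * x; y; m * y; x * y; m * (x * y)].
  by rewrite e8 /= !inE !(inj_eq (mulIg y)) !Xg !XY.
have p8 : perm_eq (enum 'Q_8)
    [:: 1; m; x; m * x; y; m * y; x * y; m * (x * y)].
  rewrite perm_sym uniq_perm ?enum_uniq //.
  have sub : {subset [:: 1; m; x; m * x; y; m * y; x * y; m * (x * y)]
      <= enum 'Q_8} by move=> g _; rewrite mem_enum in_setT.
  have le8 : size (enum 'Q_8) <= 8 by rewrite -cardE oG.
  by have [_] := uniq_min_size u8 sub le8.
have x2 : x ^+ 2 = m by [].
have [xx yy] : x * x = m /\ y * y = m by [].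
have m1 : m != 1 by apply/eqP => m1; have := Xg 2 0; rewrite -/m m1 expg0 eqxx.
clearbody m.
exists x, y, (x * y), m; split=> //; split=> //.
- move=> g; have : g \in enum 'Q_8 by rewrite mem_enum in_setT.
  rewrite (perm_mem p8) !inE.
  have mm : commute m m by [].
  rewrite -/(commute m g).
  by do 7?[case/predU1P=> [->|]]; last move/eqP->;
    do ?[by [] | apply: commute1 | apply: commuteM].
- by rewrite expgS expg1 -mulgA (mulgA y x) yx -!mulgA yy -mx (mulgA m m) m2 mul1g.
- by rewrite mulgA yx -!mulgA yy -mx mulgA m2 mul1g.
- by rewrite -mulgA yx mulgA -mx -mulgA (mulgA x x) xx mulgA m2 mul1g.
- by rewrite -mulgA yy mx.
- by rewrite mulgA xx.
Qed.

(* Main.v *)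
Require Import Defs.
From mathcomp Require Import all_boot all_order all_fingroup all_algebra.
From mathcomp Require Import all_solvable.

(** Over any nonzero ring, [groupRing_of] embeds the group multiplicatively in its group ring, so a
    commutative group ring forces a commutative group. But the quaternion group is not commutative:
    ij = k, while ji = -k differs from k. *)

Lemma groupRing_of_inj (K : nzRingType) (gT : finGroupType) :
  injective (@groupRing_of K gT).
Proof.
move=> g h /ffunP/(_ g)/eqP; rewrite !ffunE eqxx.
by case: (eqVneq g h) => // _; rewrite GRing.oner_eq0.
Qed.

Lemma groupRing_field_commute (K : nzRingType) (gT : finGroupType) :
  is_field (groupRing K gT) -> forall g h : gT, commute g h.
Proof.
case=> mulC _ _ g h.
by apply: (@groupRing_of_inj K); rewrite !groupRing_ofM mulC.
Qed.

Lemma quaternion8_not_commutative : ~ forall g h : 'Q_8%type, commute g h.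
Proof.
have [i [j [k [m [[m1 _ _] _ [ij _ _] [ji _ _] _]]]]] := quaternion8_table.
move=> /(_ i j); rewrite /commute ij ji => /esym/eqP.
(* Cancelling [k] in [m * k = k] would give [m = 1]. *)
by rewrite eq_mulgV1 mulgK (negPf m1).
Qed.

Theorem mainTheorem2 :
  ~ is_field (groupRing 'F_2 'Q_8) /\ ~ is_field (groupRing 'F_3 'Q_8).
Proof.
by split=> /groupRing_field_commute/quaternion8_not_commutative.
Qed.
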